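(* Let $(X,r)$ be a braided set and let $S=S(X,r)$ be the associated monoid. Then the left and right actions ${}^{(\ )}\bullet:X\times X\to X$ and $\bullet^{(\ )}:X\times X\to X$ defined via $r(x,y)=({}^xy,x^y)$ can be extended in a unique way to a left and a right action $${}^{(\ )}\bullet:S\times S\to S,\qquad \bullet^{(\ )}:S\times S\to S$$ which make $S$ a strong graded $\mathbf{M3}$-monoid. The associated bijective map $r_S$ restricts to $r$ on $X\times X$.
   Context: A braided set $(X,r)$ is a nonempty set $X$ with a bijective map $r:X\times X\to X\times X$, $r(x,y)=({}^xy,x^y)$, satisfying $r^{12}r^{23}r^{12}=r^{23}r^{12}r^{23}$ on $X^3$ ($r^{12}=r\times\mathrm{id}$, $r^{23}=\mathrm{id}\times r$). No non-degeneracy, involutivity or finiteness is assumed. The associated monoid $S(X,r)$ is generated by $X$ with defining relations $xy=zt$ whenever $r(x,y)=(z,t)$; it is graded by length, $S^1=X$. Matched pair of monoids $(S,T)$: monoids with maps $T\times S\to S$, $(a,u)\mapsto{}^au$ and $T\times S\to T$, $(a,u)\mapsto a^u$ such that for all $a,b\in T$, $u,v\in S$: ${}^a1=1$, ${}^1u=u$, $1^u=1$, $a^1=a$; ${}^{ab}u={}^a({}^bu)$, $a^{uv}=(a^u)^v$; ${}^a(uv)=({}^au)({}^{a^u}v)$, $(ab)^u=(a^{{}^bu})(b^u)$. The matched pair is strong if $r_{T,S}:T\times S\to S\times T$, $(a,u)\mapsto({}^au,a^u)$ is bijective. An $\mathbf{M3}$-monoid is a monoid $S$ with a matched pair $(S,S)$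 such that ${}^uv\,u^v=uv$ in $S$ for all $u,v\in S$; its associated map is $r_S(u,v)=({}^uv,u^v)$. It is strong if $(S,S)$ is strong (equivalently $r_S$ is bijective), and graded if $S$ is graded by length, generated in degree one, and the actions preserve length: $|{}^au|=|u|=|u^a|$ for all $a,u\in S$. *)

(* Defs.v *)
From HB Require Import structures.
From mathcomp Require Import all_boot.
From mathcomp Require Import boolp.

Set Implicit Arguments.
Unset Strict Implicit.
Unset Printing Implicit Defensive.

Local Open Scope quotient_scope.
Local Open Scope group_scope.

Definition r12 (X : Type) (r : X * X -> X * X) (t : X * X * X) : X * X * X :=
  let: (x, y, z) := t in
  let: (x', y') := r (x, y) in (x', y', z).

Definition r23 (X : Type) (r : X * X -> X * X) (t : X * X * X) : X * X * X :=
  let: (x, y, z) := t in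
  let: (y', z') := r (y, z) in (x, y', z').

Record braided_set (X : Type) (r : X * X -> X * X) : Prop := BraidedSet {
  braided_nonempty : inhabited X;
  braided_bij : bijective r;
  braided_ybe : forall t, r12 r (r23 r (r12 r t)) = r23 r (r12 r (r23 r t))
}.

(* The congruence of the free monoid on [X] generated by [xy = zt] whenever
   [r (x, y) = (z, t)]. *)
Inductive word_congr (X : Type) (r : X * X -> X * X) : seq X -> seq X -> Prop :=
| WordRel x y z t of r (x, y) = (z, t) : word_congr r [:: x; y] [:: z; t]
| WordRefl u : word_congr r u u
| WordSym u v of word_congr r u v : word_congr r v u
| WordTrans u v w of word_congr r u v & word_congr r v w : word_congr r u w
| WordCat u u' v v' of word_congr r u u' & word_congr r v v' :
    word_congr r (u ++ v) (u' ++ v').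

Definition word_eq (X : Type) (r : X * X -> X * X) : rel (seq {classic X}) :=
  fun u v => `[< word_congr r u v >].

Lemma word_eq_equiv (X : Type) (r : X * X -> X * X) :
  equiv_class_of (word_eq r).
Proof.
split=> [u|u v|v u w].
- by apply/asboolP; apply: WordRefl.
- by apply/asboolP/asboolP; apply: WordSym.
- by move=> /asboolP uv /asboolP vw; apply/asboolP; apply: WordTrans uv vw.
Qed.

Canonical word_eq_rel (X : Type) (r : X * X -> X * X) :=
  EquivRelPack (word_eq_equiv r).

(* The monoid S(X, r); [r] need not be braided. *)
Definition assoc_monoid (X : Type) (r : X * X -> X * X) : Type :=
  {eq_quot word_eq_rel r}.

HB.instance Definition _ X r := Choice.on (@assoc_monoid X r).
HB.instance Definition _ X r := EqQuotient.on (@assoc_monoid X r).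

Definition word_class (X : Type) (r : X * X -> X * X) (w : seq X) :
  assoc_monoid r := \pi_(assoc_monoid r) (w : seq {classic X}).

Lemma word_classP (X : Type) (r : X * X -> X * X) (u v : seq X) :
  word_class r u = word_class r v <-> word_congr r u v.
Proof.
split; first by move=> /eqmodP/asboolP.
by move=> uv; apply/eqmodP/asboolP.
Qed.

Lemma word_class_repr (X : Type) (r : X * X -> X * X) (u : assoc_monoid r) :
  word_class r (repr u) = u.
Proof. exact: reprK. Qed.

Lemma repr_word_class (X : Type) (r : X * X -> X * X) (w : seq X) :
  word_congr r (repr (word_class r w)) w.
Proof. by apply/word_classP; rewrite word_class_repr. Qed.

Definition assoc_mul (X : Type) (r : X * X -> X * X) (u v : assoc_monoid r) :
  assoc_monoid r := word_class r (repr u ++ repr v).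

Definition assoc_one (X : Type) (r : X * X -> X * X) : assoc_monoid r :=
  word_class r [::].

Lemma assoc_mulE (X : Type) (r : X * X -> X * X) (u v : seq X) :
  assoc_mul (word_class r u) (word_class r v) = word_class r (u ++ v).
Proof. by apply/word_classP; apply: WordCat; apply: repr_word_class. Qed.

Lemma assoc_mulA (X : Type) (r : X * X -> X * X) :
  associative (@assoc_mul X r).
Proof.
move=> u v w; rewrite -(word_class_repr u) -(word_class_repr v).
by rewrite -(word_class_repr w) !assoc_mulE catA.
Qed.

Lemma assoc_mul1 (X : Type) (r : X * X -> X * X) :
  left_id (assoc_one r) (@assoc_mul X r).
Proof. by move=> u; rewrite -(word_class_repr u) assoc_mulE. Qed.

Lemma assoc_mul1r (X : Type) (r : X * X -> X * X) :
  right_id (assoc_one r) (@assoc_mul X r).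
Proof. by move=> u; rewrite -(word_class_repr u) assoc_mulE cats0. Qed.

HB.instance Definition _ X r := isMonoid.Build (@assoc_monoid X r)
  (@assoc_mulA X r) (@assoc_mul1 X r) (@assoc_mul1r X r).

Definition gen (X : Type) (r : X * X -> X * X) (x : X) : assoc_monoid r :=
  word_class r [:: x].

Definition word_length (X : Type) (r : X * X -> X * X) (u : assoc_monoid r) :
  nat := size (repr u).

Lemma word_congr_size (X : Type) (r : X * X -> X * X) (u v : seq X) :
  word_congr r u v -> size u = size v.
Proof.
by elim=> // [u' v' w _ -> _ ->|u1 u2 v1 v2 _ e1 _ e2] //; rewrite !size_cat e1 e2.
Qed.

Lemma word_congr_small (X : Type) (r : X * X -> X * X) (u v : seq X) :
  word_congr r u v -> size u <= 1 -> u = v.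
Proof.
elim=> // [u' v' uv IH le1|u' v' w uv IH1 vw IH2 le1|u1 u2 v1 v2 _ IH1 _ IH2].
- by rewrite IH // (word_congr_size uv).
- by rewrite IH1 // IH2 // -(word_congr_size uv).
rewrite size_cat => le1.
by rewrite (IH1 (leq_trans (leq_addr _ _) le1))
           (IH2 (leq_trans (leq_addl _ _) le1)).
Qed.

Lemma word_lengthE (X : Type) (r : X * X -> X * X) (w : seq X) :
  word_length (word_class r w) = size w.
Proof. exact: word_congr_size (repr_word_class r w). Qed.

Lemma word_lengthM (X : Type) (r : X * X -> X * X) (u v : assoc_monoid r) :
  word_length (u * v) = (word_length u + word_length v)%N.
Proof. by rewrite [u * v]/(word_class _ _) word_lengthE size_cat. Qed.

(* The next two lemmas justify identifying [X] with the degree-one part of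
   S(X, r) along [gen]. *)
Lemma gen_inj (X : Type) (r : X * X -> X * X) : injective (gen r).
Proof. by move=> x y /word_classP/word_congr_small => /(_ isT) []. Qed.

Lemma word_length1P (X : Type) (r : X * X -> X * X) (u : assoc_monoid r) :
  word_length u = 1%N <-> exists x, u = gen r x.
Proof.
split=> [|[x ->]]; last by rewrite word_lengthE.
rewrite -{2}(word_class_repr u) /word_length.
by case: (repr u) => [|x [|]] // _; exists x.
Qed.

(* [lact a u] is the left action of [a] on [u], written as a left superscript
   on paper, and [ract a u] is the right action [a ^ u] of [u] on [a]. *)
Record matched_pair (S T : monoidType)
    (lact : T -> S -> S) (ract : T -> S -> T) : Prop := MatchedPair {
  lact1 : forall a, lact a 1 = 1;
  act1l : forall u, lact 1 u = u;
  ract1 : forall u, ract 1 u = 1;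
  act1r : forall a, ract a 1 = a;
  lactA : forall a b u, lact (a * b) u = lact a (lact b u);
  ractA : forall a u v, ract a (u * v) = ract (ract a u) v;
  lactM : forall a u v, lact a (u * v) = lact a u * lact (ract a u) v;
  ractM : forall a b u, ract (a * b) u = ract a (lact b u) * ract b u
}.

Definition matched_map (S T : monoidType)
    (lact : T -> S -> S) (ract : T -> S -> T) (p : T * S) : S * T :=
  (lact p.1 p.2, ract p.1 p.2).

Definition strong_matched_pair (S T : monoidType)
    (lact : T -> S -> S) (ract : T -> S -> T) : Prop :=
  matched_pair lact ract /\ bijective (matched_map lact ract).

Definition M3_monoid (S : monoidType) (lact ract : S -> S -> S) : Prop :=
  matched_pair lact ract /\ forall u v, lact u v * ract u v = u * v.

Record graded_by_length (S : monoidType) (len : S -> nat) : Prop :=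
  GradedByLength {
  len1 : len 1 = 0%N;
  lenM : forall u v, len (u * v) = (len u + len v)%N;
  len1_gen : forall u, exists s : seq S,
    {in s, forall x, len x = 1%N} /\ u = \prod_(x <- s) x
}.

Record strong_graded_M3_monoid (S : monoidType) (len : S -> nat)
    (lact ract : S -> S -> S) : Prop := StrongGradedM3Monoid {
  sgM3_M3 : M3_monoid lact ract;
  sgM3_strong : strong_matched_pair lact ract;
  sgM3_graded : graded_by_length len;
  sgM3_len : forall a u, len (lact a u) = len u /\ len (ract u a) = len u
}.

Definition extends_actions (X : Type) (r : X * X -> X * X)
    (lact ract : assoc_monoid r -> assoc_monoid r -> assoc_monoid r) : Prop :=
  forall x y : X,
    lact (gen r x) (gen r y) = gen r (r (x, y)).1 /\
    ract (gen r x) (gen r y) = gen r (r (x, y)).2.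

(* Main.v *)
Require Import Defs.
From mathcomp Require Import all_boot.
From mathcomp Require Import boolp.

(** On words, [r] induces a map pushing every letter of [u] to the right of
    every letter of [v], one elementary step at a time. The braid relation on
    three letters says that this map respects the congruence in both arguments,
    and in fact more: [a ^ v] with [a] a word depends only on the class of [v],
    and the action of [u] on a word only on the class of [u]. Hence the word
    actions descend to S(X, r). The inverse of the induced map is the map
    induced by the inverse of [r], which is braided with the same associated
    congruence. Uniqueness holds because the matched pair axioms compute both
    actions on products of generators. *)

Local Open Scope group_scope.

Set Implicit Arguments.
Unset Strict Implicit.
Unset Printing Implicit Defensive.

(** * The two actions on words over [X] *)

Section WordActions.
Variables (X : Type) (r : X * X -> X * X).
Implicit Types (x y z : X) (u v w : seq X).

(** For a letter [x] crossing the word [v], the first component plays the role of [^x v] and the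
    second that of [x ^ v]. *)
Fixpoint letter_push x v : seq X * X :=
  if v is y :: v' then
    let p := r (x, y) in let q := letter_push p.2 v' in (p.1 :: q.1, q.2)
  else ([::], x).

Fixpoint word_lact u v : seq X :=
  if u is x :: u' then (letter_push x (word_lact u' v)).1 else v.

(** The law [(ab)^v = (a^(^b v)) (b^v)] read as a recursion on the acted word. *)
Fixpoint word_ract u v : seq X :=
  if u is x :: u' then (letter_push x (word_lact u' v)).2 :: word_ract u' v
  else [::].

Lemma letter_push_cat x v w :
  letter_push x (v ++ w) =
  ((letter_push x v).1 ++ (letter_push (letter_push x v).2 w).1,
   (letter_push (letter_push x v).2 w).2).
Proof. by elim: v x => [|y v IH] x /=; [case: letter_push|rewrite IH]. Qed.

Lemma word_lact0 u : word_lact u [::] = [::].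
Proof. by elim: u => //= x u ->. Qed.

Lemma word_ract0 u : word_ract u [::] = u.
Proof. by elim: u => //= x u ->; rewrite word_lact0. Qed.

(** From here to [word_ract_catr], the multiplicative laws of a matched pair hold as equalities of
    words, so S(X, r) inherits them once the actions descend. *)
Lemma word_lact_catl u v w :
  word_lact (u ++ v) w = word_lact u (word_lact v w).
Proof. by elim: u => //= x u ->. Qed.

Lemma word_ract_catl u v w :
  word_ract (u ++ v) w = word_ract u (word_lact v w) ++ word_ract v w.
Proof. by elim: u => //= x u ->; rewrite word_lact_catl. Qed.

Lemma word_lact_catr u v w :
  word_lact u (v ++ w) = word_lact u v ++ word_lact (word_ract u v) w.
Proof. by elim: u => //= x u ->; rewrite letter_push_cat. Qed.

Lemma word_ract_catr u v w :
  word_ract u (v ++ w) = word_ract (word_ract u v) w.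
Proof.
by elim: u => //= x u ->; rewrite word_lact_catr letter_push_cat.
Qed.

Lemma size_word_lact u v : size (word_lact u v) = size v.
Proof.
elim: u => //= x u <-.
by elim: (word_lact u v) x => //= y w IH x; rewrite IH.
Qed.

Lemma size_word_ract u v : size (word_ract u v) = size u.
Proof. by elim: u => //= x u ->. Qed.

Lemma word_congr_rel x y :
  word_congr r [:: x; y] [:: (r (x, y)).1; (r (x, y)).2].
Proof. by apply: WordRel; case: (r _). Qed.

Lemma word_congr_cons x u v : word_congr r u v -> word_congr r (x :: u) (x :: v).
Proof. exact: (@WordCat _ _ [:: x] [:: x] _ _ (WordRefl _ _)). Qed.

Lemma letter_push_congr x v :
  word_congr r ((letter_push x v).1 ++ [:: (letter_push x v).2]) (x :: v).
Proof.
elim: v x => [|y v IH] x /=; first exact: WordRefl.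
apply: WordTrans (word_congr_cons _ (IH _)) _; apply: WordSym.
exact: (@WordCat _ _ [:: _; _] [:: _; _] _ _ (word_congr_rel x y) (WordRefl _ _)).
Qed.

(** The M3 identity at the level of words: each elementary crossing replaces two adjacent letters by
    a congruent pair. *)
Lemma word_act_congr u v :
  word_congr r (word_lact u v ++ word_ract u v) (u ++ v).
Proof.
elim: u => [|x u IH] /=; first by rewrite cats0; apply: WordRefl.
apply: WordTrans (word_congr_cons x IH); rewrite -cat1s catA.
exact: WordCat (letter_push_congr _ _) (WordRefl _ _).
Qed.

(** * Compatibility of the word actions with the congruence *)

Hypothesis ybe : forall t, r12 r (r23 r (r12 r t)) = r23 r (r12 r (r23 r t)).

(** The braid relation by coordinates: [p], [q], [s] are the successive crossings on one side, [p'],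
    [q'], [s'] those on the other. *)
Lemma ybe3 x y z :
  let p := r (x, y) in let q := r (p.2, z) in let s := r (p.1, q.1) in
  let p' := r (y, z) in let q' := r (x, p'.1) in let s' := r (q'.2, p'.2) in
  [/\ s.1 = q'.1, s.2 = s'.1 & q.2 = s'.2].
Proof.
move: (ybe (x, y, z)); rewrite /r12 /r23 /=.
case: (r (x, y)) => a b /=; case: (r (b, z)) => c d /=.
case: (r (a, c)) => e f /=; case: (r (y, z)) => h i /=.
by case: (r (x, h)) => j k /=; case: (r (k, i)) => l m /= [-> -> ->].
Qed.

(** The outgoing letter must agree exactly, not up to congruence, because in a concatenation it is
    the letter that goes on to cross the second factor. *)
Lemma letter_push_congrr x v v' : word_congr r v v' ->
  word_congr r (letter_push x v).1 (letter_push x v').1 /\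
  (letter_push x v).2 = (letter_push x v').2.
Proof.
move=> vv'; elim: vv' x => {v v'}.
- move=> y z a b ryz x /=.
  have [] := ybe3 x y z; rewrite ryz /= => e1 e2 e3; split=> //.
  (* The third crossing [s] of the braid relation is the defining relation linking the two output
     words. *)
  by rewrite -e1 -e2; apply: word_congr_rel.
- by move=> u x; split=> //; apply: WordRefl.
- by move=> u v _ IH x; have [/WordSym ? ->] := IH x.
- move=> u v w _ IH1 _ IH2 x; have [uv ->] := IH1 x; have [vw ->] := IH2 x.
  by split=> //; apply: WordTrans uv vw.
- move=> u u' v v' _ IH1 _ IH2 x; rewrite !letter_push_cat /=.
  have [uu' ->] := IH1 x; have [vv' ->] := IH2 (letter_push x u').2.
  by split=> //; apply: WordCat.
Qed.

Lemma word_act_congrr u v v' : word_congr r v v' ->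
  word_congr r (word_lact u v) (word_lact u v') /\
  word_ract u v = word_ract u v'.
Proof.
move=> vv'; elim: u => //= x u [IH ->].
by have [? ->] := letter_push_congrr x IH.
Qed.

Lemma word_act_congrl u u' v : word_congr r u u' ->
  word_lact u v = word_lact u' v /\
  word_congr r (word_ract u v) (word_ract u' v).
Proof.
move=> uu'; elim: uu' v => {u u'}.
(* The letters stay general in the induction on [v]: after crossing [a], both pairs have changed,
   but by the braid relation [r] still sends the first to the second. *)
- move=> x y z t rxy v; elim: v x y z t rxy => [|a v IH] x y z t rxy.
    by rewrite !word_lact0 !word_ract0; split=> //; apply: WordRel.
  rewrite -[a :: v]cat1s !word_lact_catr !word_ract_catr /=.
  have [] := ybe3 x y a; rewrite rxy /= => e1 e2 e3.
  have /= [|-> ?] := IH (r (x, (r (y, a)).1)).2 (r (y, a)).2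
    (r (z, (r (t, a)).1)).2 (r (t, a)).2.
    by rewrite e2 e3; case: (r _).
  by rewrite e1; split.
- by move=> u v; split=> //; apply: WordRefl.
- by move=> u v _ IH w; have [-> /WordSym] := IH w.
- move=> u v w _ IH1 _ IH2 s; have [-> uv] := IH1 s; have [-> vw] := IH2 s.
  by split=> //; apply: WordTrans uv vw.
- move=> u u' v v' _ IH1 _ IH2 w; rewrite !word_lact_catl !word_ract_catl.
  have [-> ?] := IH2 w; have [-> ?] := IH1 (word_lact v' w).
  by split=> //; apply: WordCat.
Qed.

Lemma word_act_congr2 u u' v v' : word_congr r u u' -> word_congr r v v' ->
  word_congr r (word_lact u v) (word_lact u' v') /\
  word_congr r (word_ract u v) (word_ract u' v').
Proof.
move=> uu' vv'; have [-> ?] := word_act_congrl v uu'.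
by have [? <-] := word_act_congrr u' vv'.
Qed.

End WordActions.

(** * Reversing the crossings with the inverse of [r] *)

Section Inverse.
Variables (X : Type) (r g : X * X -> X * X).
Hypothesis rK : cancel r g.

(** The letter that came out on the right is pulled back leftwards through the word by [g], undoing
    the crossings in reverse order. *)
Lemma letter_pushK x v :
  word_lact g (letter_push r x v).1 [:: (letter_push r x v).2] = [:: x] /\
  word_ract g (letter_push r x v).1 [:: (letter_push r x v).2] = v.
Proof.
elim: v x => //= y v IH x; have [-> ->] := IH (r (x, y)).2.
by rewrite /= -surjective_pairing rK.
Qed.

Lemma word_actK u v :
  word_lact g (word_lact r u v) (word_ract r u v) = u /\
  word_ract g (word_lact r u v) (word_ract r u v) = v.
Proof.
elim: u => [|x u [IHl IHr]] /=; first by rewrite word_lact0 word_ract0.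
(* Pulling back the leading letter first restores [x] and the word [word_lact r u v], where the
   induction hypothesis applies. *)
rewrite -cat1s word_lact_catr word_ract_catr.
by have [-> ->] := letter_pushK x (word_lact r u v); rewrite IHl IHr.
Qed.

Hypothesis gK : cancel g r.

Lemma inverse_ybe :
  (forall t, r12 r (r23 r (r12 r t)) = r23 r (r12 r (r23 r t))) ->
  forall t, r12 g (r23 g (r12 g t)) = r23 g (r12 g (r23 g t)).
Proof.
move=> ybe t.
have r12K : cancel (r12 r) (r12 g).
  by move=> [[x y] z] /=; case E: (r _) => [a b] /=; rewrite -E rK.
have r23K : cancel (r23 r) (r23 g).
  by move=> [[x y] z] /=; case E: (r _) => [a b] /=; rewrite -E rK.
have g12K : cancel (r12 g) (r12 r).
  by move=> [[x y] z] /=; case E: (g _) => [a b] /=; rewrite -E gK.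
have g23K : cancel (r23 g) (r23 r).
  by move=> [[x y] z] /=; case E: (g _) => [a b] /=; rewrite -E gK.
(* At this triple the right side of the braid relation collapses to [t]; it remains to strip the
   left side with [g]. *)
have := ybe (r23 g (r12 g (r23 g t))); rewrite g23K g12K g23K => E.
by rewrite -{1}E r12K r23K r12K.
Qed.

Lemma word_congr_inverse u v : word_congr r u v -> word_congr g u v.
Proof.
elim=> {u v} [x y z t rxy|u|u v _|u v w _ uv _|u u' v v' _ uu' _].
- by apply/WordSym/WordRel; rewrite -rxy rK.
- exact: WordRefl.
- exact: WordSym.
- exact: WordTrans.
- exact: WordCat.
Qed.

End Inverse.

(** * Descent of the actions to S(X, r), and uniqueness *)

Section MonoidActions.
Variables (X : Type) (r : X * X -> X * X).
Hypothesis ybe : forall t, r12 r (r23 r (r12 r t)) = r23 r (r12 r (r23 r t)).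

Definition assoc_lact (a u : assoc_monoid r) : assoc_monoid r :=
  word_class r (word_lact r (repr a) (repr u)).

Definition assoc_ract (a u : assoc_monoid r) : assoc_monoid r :=
  word_class r (word_ract r (repr a) (repr u)).

Lemma assoc_lactE u v :
  assoc_lact (word_class r u) (word_class r v) = word_class r (word_lact r u v).
Proof.
by apply/word_classP; have [] :=
  word_act_congr2 ybe (repr_word_class r u) (repr_word_class r v).
Qed.

Lemma assoc_ractE u v :
  assoc_ract (word_class r u) (word_class r v) = word_class r (word_ract r u v).
Proof.
by apply/word_classP; have [] :=
  word_act_congr2 ybe (repr_word_class r u) (repr_word_class r v).
Qed.

Lemma word_class_cat u v :
  word_class r (u ++ v) = word_class r u * word_class r v.
Proof. exact/esym/assoc_mulE. Qed.

Lemma assoc_matched_pair : matched_pair assoc_lact assoc_ract.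
Proof.
have one : 1 = word_class r [::] by [].
split=> a; rewrite -(word_class_repr a) ?one.
- by rewrite assoc_lactE word_lact0.
- by rewrite assoc_lactE.
- by rewrite assoc_ractE.
- by rewrite assoc_ractE word_ract0.
- move=> b u; rewrite -(word_class_repr b) -(word_class_repr u).
  by rewrite -word_class_cat !assoc_lactE word_lact_catl.
- move=> b u; rewrite -(word_class_repr b) -(word_class_repr u).
  by rewrite -word_class_cat !assoc_ractE word_ract_catr.
- move=> b u; rewrite -(word_class_repr b) -(word_class_repr u).
  rewrite -word_class_cat assoc_ractE !assoc_lactE.
  by rewrite -word_class_cat word_lact_catr.
- move=> b u; rewrite -(word_class_repr b) -(word_class_repr u).
  rewrite -word_class_cat assoc_lactE !assoc_ractE.
  by rewrite -word_class_cat word_ract_catl.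
Qed.

Lemma assoc_M3_monoid : M3_monoid assoc_lact assoc_ract.
Proof.
split=> [|u v]; first exact: assoc_matched_pair.
rewrite -(word_class_repr u) -(word_class_repr v) assoc_lactE assoc_ractE.
by rewrite -!word_class_cat; apply/word_classP/word_act_congr.
Qed.

Lemma assoc_matched_map_bij : bijective r ->
  bijective (matched_map assoc_lact assoc_ract).
Proof.
move=> [g rK gK]; have ybeg := inverse_ybe rK gK ybe.
(* The inverse acts with [g] on representatives but takes classes for [r]; since [r] and [g]
   generate the same congruence, it is well defined. *)
pose h (p : assoc_monoid r * assoc_monoid r) :=
  (word_class r (word_lact g (repr p.1) (repr p.2)),
   word_class r (word_ract g (repr p.1) (repr p.2))).
have hE u v : h (word_class r u, word_class r v) =
    (word_class r (word_lact g u v), word_class r (word_ract g u v)).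
  have toG w := word_congr_inverse rK (repr_word_class r w).
  have [cl cr] := word_act_congr2 ybeg (toG u) (toG v).
  by congr (_, _); apply/word_classP; apply: (word_congr_inverse gK).
exists h => -[u v].
  rewrite /matched_map /= -(word_class_repr u) -(word_class_repr v).
  rewrite assoc_lactE assoc_ractE hE.
  by have [-> ->] := word_actK rK (repr u) (repr v).
rewrite -(word_class_repr u) -(word_class_repr v) hE.
rewrite /matched_map /= assoc_lactE assoc_ractE.
by have [-> ->] := word_actK gK (repr u) (repr v).
Qed.

Lemma assoc_graded_by_length : graded_by_length (@word_length X r).
Proof.
split; [exact: word_lengthE|exact: word_lengthM|move=> u].
rewrite -(word_class_repr u); elim: (repr u : seq X) => [|x w [s [s1 ws]]].
  by exists [::]; rewrite big_nil.
exists (gen r x :: s); split=> [y|].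
  by rewrite inE => /predU1P[->|/s1//]; rewrite word_lengthE.
by rewrite big_cons -ws -word_class_cat.
Qed.

Lemma assoc_strong_graded : bijective r ->
  strong_graded_M3_monoid (@word_length X r) assoc_lact assoc_ract.
Proof.
move=> r_bij; have M3 := assoc_M3_monoid; split=> //.
- by split; [case: M3|exact: assoc_matched_map_bij].
- exact: assoc_graded_by_length.
- move=> a u; rewrite -(word_class_repr a) -(word_class_repr u).
  by rewrite assoc_lactE assoc_ractE !word_lengthE size_word_lact size_word_ract.
Qed.

Lemma assoc_extends : extends_actions assoc_lact assoc_ract.
Proof. by move=> x y; rewrite /gen assoc_lactE assoc_ractE. Qed.

(** The core of uniqueness: the axioms [lactM] and [ractA] reduce a generator acting on a word to
    its values on generators, then [lactA] and [ractM] treat an arbitrary acting word. *)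
Lemma matched_pair_word_act
    (lact ract : assoc_monoid r -> assoc_monoid r -> assoc_monoid r) u v :
  extends_actions lact ract -> matched_pair lact ract ->
  lact (word_class r u) (word_class r v) = word_class r (word_lact r u v) /\
  ract (word_class r u) (word_class r v) = word_class r (word_ract r u v).
Proof.
move=> ext mp; have one : word_class r [::] = 1 by [].
have consE x w : word_class r (x :: w) = gen r x * word_class r w.
  by rewrite -word_class_cat.
have letterE x w : lact (gen r x) (word_class r w) =
      word_class r (letter_push r x w).1 /\
    ract (gen r x) (word_class r w) = gen r (letter_push r x w).2.
  elim: w x => [|y w IH] x /=; first by rewrite one (lact1 mp) (act1r mp).
  rewrite !consE (lactM mp) (ractA mp).
  by have [-> ->] := ext x y; have [-> ->] := IH (r (x, y)).2.
elim: u => [|x u [IHl IHr]] /=; first by rewrite one (act1l mp) (ract1 mp).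
rewrite !consE (lactA mp) (ractM mp) IHl IHr.
by have [-> ->] := letterE x (word_lact r u v).
Qed.

End MonoidActions.

Theorem theorem3p6 (X : Type) (r : X * X -> X * X) (hr : braided_set r) :
  exists lact ract : assoc_monoid r -> assoc_monoid r -> assoc_monoid r,
    [/\ extends_actions lact ract,
        strong_graded_M3_monoid (@word_length X r) lact ract,
        forall lact' ract' : assoc_monoid r -> assoc_monoid r -> assoc_monoid r,
          extends_actions lact' ract' ->
          strong_graded_M3_monoid (@word_length X r) lact' ract' ->
          lact' = lact /\ ract' = ract
      & forall x y : X,
          matched_map lact ract (gen r x, gen r y)
          = (gen r (r (x, y)).1, gen r (r (x, y)).2)].
Proof.
have [_ r_bij ybe] := hr.
exists (@assoc_lact X r), (@assoc_ract X r); split.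
- exact: assoc_extends.
- exact: assoc_strong_graded.
- move=> lact' ract' ext' [[mp' _] _ _ _].
  split; apply/funext => u; apply/funext => v;
    rewrite -(word_class_repr u) -(word_class_repr v);
    have [lE rE] := matched_pair_word_act (repr u) (repr v) ext' mp'.
  + by rewrite lE assoc_lactE.
  + by rewrite rE assoc_ractE.
- by move=> x y; rewrite /matched_map /=; have [-> ->] := assoc_extends ybe x y.
Qed.
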